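(* Let $\Phi$ be a Turing functional such that the induced semi-measure $\rho=\lambda_\Phi$ is computable. Then for every $X\in\mathsf{MLR}\cap\mathrm{dom}(\Phi)$, $\Phi(X)\in\mathsf{MLR}_\rho$.
   Context: $2^\omega$ is Cantor space, $2^{<\omega}$ the set of finite binary strings, $\preceq$ the prefix order, $\varepsilon$ the empty string, $[\![\sigma]\!]=\{X\in2^\omega:\sigma\preceq X\}$ and $[\![S]\!]=\bigcup_{\sigma\in S}[\![\sigma]\!]$ for $S\subseteq2^{<\omega}$; $\lambda$ is the uniform measure. A Turing functional $\Phi$ is a c.e. set of pairs $(\sigma,\tau)$ of strings such that whenever $(\sigma,\tau),(\sigma',\tau')\in\Phi$ and $\sigma\preceq\sigma'$, $\tau,\tau'$ are comparable. For $X\in2^\omega$, $\Phi^X$ is the maximal finite or infinite sequence extending every $\tau$ with $(\sigma,\tau)\in\Phi$ for some $\sigma\preceq X$; $\mathrm{dom}(\Phi)=\{X:\Phi^X\text{ infinite}\}$ and $\Phi(X)=\Phi^X$ for $X\in\mathrm{dom}(\Phi)$. The induced semi-measure is $\lambda_\Phi(\sigma)=\lambda(\{X:\Phi^X\succeq\sigma\})$. A semi-measure is $\rho:2^{<\omega}\to[0,1]$ with $\rho(\varepsilon)=1$ and $\rho(\sigma)\ge\rho(\sigma0)+\rho(\sigma1)$; it is computable if its values are uniformly computable reals. For $E\subseteq 2^{<\omega}$, $\rho(E)=\sum_{\sigma\in E}\rho(\sigma)$. A $\rho$-Martin-Löf test is a uniformly c.e. sequence $(U_i)_{i\in\omega}$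 of subsets of $2^{<\omega}$ with $\rho(U_i)\le2^{-i}$ for all $i$; $X$ is in $\mathsf{MLR}_\rho$ iff for every such test $X\notin\bigcap_i[\![U_i]\!]$. $\mathsf{MLR}$ is the set of Martin-Löf random sequences for $\lambda$. *)

(* Defs.v *)
From Stdlib Require Cantor.
From HB Require Import structures.
From mathcomp Require Import all_boot all_order all_algebra.
From mathcomp Require Import all_classical all_reals all_analysis.
Set Implicit Arguments. Unset Strict Implicit. Unset Printing Implicit Defensive.
Import Order.TTheory GRing.Theory Num.Theory.
Local Open Scope classical_set_scope.
Local Open Scope ring_scope.

Definition npair (x y : nat) : nat := Cantor.to_nat (x, y).
Definition nfst (n : nat) : nat := (Cantor.of_nat n).1.
Definition nsnd (n : nat) : nat := (Cantor.of_nat n).2.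

Inductive prf : Type :=
| pr_zero
| pr_succ
| pr_fst
| pr_snd
| pr_pair (f g : prf)
| pr_comp (f g : prf)
| pr_rec (f g : prf)
| pr_mu (f : prf).

Inductive eval : prf -> nat -> nat -> Prop :=
| ev_zero x : eval pr_zero x 0
| ev_succ x : eval pr_succ x x.+1
| ev_fst x : eval pr_fst x (nfst x)
| ev_snd x : eval pr_snd x (nsnd x)
| ev_pair f g x a b : eval f x a -> eval g x b -> eval (pr_pair f g) x (npair a b)
| ev_comp f g x y z : eval g x y -> eval f y z -> eval (pr_comp f g) x z
| ev_rec0 f g x y : eval f x y -> eval (pr_rec f g) (npair x 0) y
| ev_recS f g x n y z : eval (pr_rec f g) (npair x n) y ->
    eval g (npair x (npair n y)) z -> eval (pr_rec f g) (npair x n.+1) z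
| ev_mu f x n : eval f (npair x n) 0 ->
    (forall m, (m < n)%N -> exists k, eval f (npair x m) k.+1) ->
    eval (pr_mu f) x n.

Definition halts (e : prf) (x : nat) : Prop := exists y, eval e x y.

(* Bijective, computable coding of binary strings by naturals. *)
Fixpoint scode (s : seq bool) : nat :=
  match s with [::] => 0%N | b :: s' => (2 * scode s' + 1 + b)%N end.

Definition cantor := nat -> bool.

Definition pre (s : seq bool) (X : cantor) : Prop :=
  forall i, (i < size s)%N -> X i = nth false s i.

Definition cyl (s : seq bool) : set cantor := [set X | pre s X].

Definition cylS (S : set (seq bool)) : set cantor := [set X | exists2 s, S s & pre s X].

(* Uniform (Lebesgue) measure on Cantor space, as the outer measure
   generated by the cylinders:
   lambda(A) = inf { sum_n 2^-|c_n| : A subset of U_n [[c_n]] }.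
   It agrees with the uniform measure on all Borel sets. *)
Definition lam {R : realType} (A : set cantor) : \bar R :=
  ereal_inf [set (\sum_(0 <= n <oo) ((2%:R ^- size (c n) : R))%:E)%E
            | c in [set c : nat -> seq bool | A `<=` \bigcup_n cyl (c n)]].

Definition comparable_str (t t' : seq bool) : bool := prefix t t' || prefix t' t.

Definition turing_functional (Phi : seq bool -> seq bool -> Prop) : Prop :=
  (exists e, forall s t, Phi s t <-> halts e (npair (scode s) (scode t))) /\
  (forall s t s' t', Phi s t -> Phi s' t' -> prefix s s' -> comparable_str t t').

Definition out (Phi : seq bool -> seq bool -> Prop) (X : cantor) (n : nat) (b : bool)
  : Prop :=
  exists s t, [/\ Phi s t, pre s X, (n < size t)%N & nth false t n = b].

Definition out_ext (Phi : seq bool -> seq bool -> Prop) (X : cantor) (s : seq bool)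
  : Prop :=
  forall i, (i < size s)%N -> out Phi X i (nth false s i).

Definition dom (Phi : seq bool -> seq bool -> Prop) (X : cantor) : Prop :=
  forall n, exists b, out Phi X n b.

Definition lamPhi {R : realType} (Phi : seq bool -> seq bool -> Prop) (s : seq bool)
  : R := fine (lam [set X | out_ext Phi X s]).

Definition computable_sm {R : realType} (rho : seq bool -> R) : Prop :=
  exists e, forall s n, exists a,
    eval e (npair (scode s) n) a /\
    `|rho s - a%:R / 2%:R ^+ n| <= 2%:R ^- n.

Definition unif_ce (U : nat -> set (seq bool)) : Prop :=
  exists e, forall i s, U i s <-> halts e (npair i (scode s)).

Definition ml_test {R : realType} (rho : seq bool -> R) (U : nat -> set (seq bool))
  : Prop :=
  unif_ce U /\ forall i, (\esum_(s in U i) (rho s)%:E <= (2%:R ^- i : R)%:E)%E.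

Definition MLR_ {R : realType} (rho : seq bool -> R) (X : cantor) : Prop :=
  forall U, ml_test rho U -> ~ (forall i, cylS (U i) X).

Definition MLR {R : realType} (X : cantor) : Prop :=
  MLR_ (fun s : seq bool => (2%:R ^- size s : R)) X.

(* Main.v *)
(* Given a [rho]-test (U_i), let V_i be the set of strings s such that some (s, t) in Phi has
   t extending an element of U_i; then [[V_i]] contains the points of dom(Phi) that Phi maps
   into [[U_i]].  Refine V_i to a c.e. prefix-free W_i generating the same open set: the
   minimal elements of a decidable set, obtained from step-bounded evaluation of programs.
   Each s in W_i satisfies [[s]] <= {Z : Phi^Z extends u} for some u in U_i; grouping W_i
   according to u and applying Kraft's inequality (with compactness of Cantor space) to each
   group bounds the weight of W_i by rho(U_i). *)
From Stdlib Require Cantor.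
Require Import Defs.
From mathcomp Require Import all_boot all_order all_algebra.
From mathcomp Require Import finmap.
From mathcomp Require Import all_classical all_reals all_analysis.
Import Defs.
Set Implicit Arguments. Unset Strict Implicit. Unset Printing Implicit Defensive.
Import Order.TTheory GRing.Theory Num.Theory.

(** * Pairing and the evaluation relation of programs *)

Lemma nfst_npair x y : nfst (npair x y) = x.
Proof. by rewrite /nfst /npair Cantor.cancel_of_to. Qed.

Lemma nsnd_npair x y : nsnd (npair x y) = y.
Proof. by rewrite /nsnd /npair Cantor.cancel_of_to. Qed.

Lemma npair_nfst_nsnd z : npair (nfst z) (nsnd z) = z.
Proof. by rewrite /nfst /nsnd /npair -surjective_pairing Cantor.cancel_to_of. Qed.

Definition npairE := (nfst_npair, nsnd_npair).

(** The constructors for [pr_rec] have inputs of the form [npair x n], which is not a pattern; the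
    case split on [nsnd x] recovers them. *)
Lemma eval_inv e x y : eval e x y ->
  match e with
  | pr_zero => y = 0
  | pr_succ => y = x.+1
  | pr_fst => y = nfst x
  | pr_snd => y = nsnd x
  | pr_pair f g => exists a b, [/\ y = npair a b, eval f x a & eval g x b]
  | pr_comp f g => exists2 u, eval g x u & eval f u y
  | pr_rec f g =>
      if nsnd x is n.+1 then
        exists2 u, eval e (npair (nfst x) n) u & eval g (npair (nfst x) (npair n u)) y
      else eval f (nfst x) y
  | pr_mu f => eval f (npair x y) 0 /\
      forall m, m < y -> exists k, eval f (npair x m) k.+1
  end.
Proof.
case=> //= *; rewrite ?npairE //; first by eexists; eexists; split; eauto.
all: by eexists; eauto.
Qed.

(** For [pr_mu], the smaller of two distinct results would be a zero of [f] and also, lying below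
    the other one, a point where [f] has a successor value. *)
Lemma eval_det e x y y' : eval e x y -> eval e x y' -> y = y'.
Proof.
elim: e x y y' => [||||f IHf g IHg|f IHf g IHg|f IHf g IHg|f IHf] x y y'.
1-4: by move=> /eval_inv-> /eval_inv->.
- move=> /eval_inv[a [b [-> Ha Hb]]] /eval_inv[a' [b' [-> Ha' Hb']]].
  by rewrite (IHf _ _ _ Ha Ha') (IHg _ _ _ Hb Hb').
- move=> /eval_inv[u Hu H] /eval_inv[u' Hu' H'].
  by rewrite (IHg _ _ _ Hu Hu') in H; apply: IHf H H'.
- rewrite -(npair_nfst_nsnd x); elim: (nsnd x) y y' => [|n IHn] y y' /eval_inv + /eval_inv.
    by rewrite !npairE; apply: IHf.
  rewrite !npairE => -[u Hu H] [u' Hu' H'].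
  by rewrite (IHn _ _ Hu Hu') in H; apply: IHg H H'.
- move=> /eval_inv[H0 Hlt] /eval_inv[H0' Hlt'].
  case: (ltngtP y y') => // lt.
    by have [k Hk] := Hlt' _ lt; have := IHf _ _ _ H0 Hk.
  by have [k Hk] := Hlt _ lt; have := IHf _ _ _ H0' Hk.
Qed.

(** * Closure properties of computable functions and decidable predicates *)

Definition computable (f : nat -> nat) : Prop := exists e, forall x, eval e x (f x).

Definition computable2 (f : nat -> nat -> nat) : Prop :=
  computable (fun z => f (nfst z) (nsnd z)).

Definition decidable1 (P : nat -> bool) : Prop := computable (fun z => P z : nat).

Lemma computable_ext f g : f =1 g -> computable f -> computable g.
Proof. by move=> fg [e He]; exists e => x; rewrite -fg. Qed.

Lemma computable_comp f g : computable f -> computable g -> computable (fun x => f (g x)).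
Proof. by move=> [e He] [e' He']; exists (pr_comp e e') => x; apply: ev_comp. Qed.

Lemma computable_pair f g :
  computable f -> computable g -> computable (fun x => npair (f x) (g x)).
Proof. by move=> [e He] [e' He']; exists (pr_pair e e') => x; apply: ev_pair. Qed.

Lemma computable_fst f : computable f -> computable (fun x => nfst (f x)).
Proof. by apply: computable_comp; exists pr_fst => x; apply: ev_fst. Qed.

Lemma computable_snd f : computable f -> computable (fun x => nsnd (f x)).
Proof. by apply: computable_comp; exists pr_snd => x; apply: ev_snd. Qed.

Lemma computable_succ f : computable f -> computable (fun x => (f x).+1).
Proof. by apply: computable_comp; exists pr_succ => x; apply: ev_succ. Qed.

Lemma computable_id : computable (fun x => x).
Proof.
exists (pr_pair pr_fst pr_snd) => x; rewrite -{2}(npair_nfst_nsnd x).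
by apply: ev_pair; [apply: ev_fst|apply: ev_snd].
Qed.

Lemma computable_const n : computable (fun=> n).
Proof.
elim: n => [|n IHn]; last exact: computable_succ.
by exists pr_zero => x; apply: ev_zero.
Qed.

Lemma computable2_app f g h : computable2 f -> computable g -> computable h ->
  computable (fun x => f (g x) (h x)).
Proof.
move=> cf cg ch; apply: computable_ext (computable_comp cf (computable_pair cg ch)).
by move=> x; rewrite !npairE.
Qed.

Lemma computable2_l f : computable f -> computable2 (fun x _ => f x).
Proof. by move=> cf; apply: computable_comp cf (computable_fst computable_id). Qed.

(** [pr_rec] recurses on the second component of its input, so the recursion is first computed for
    an arbitrary bound [n] paired with [z], then the bound is set to [b z]. *)
Lemma computable_rec (f b : nat -> nat) (g : nat -> nat -> nat -> nat) :
  computable f -> computable b ->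
  computable (fun w => g (nfst w) (nfst (nsnd w)) (nsnd (nsnd w))) ->
  computable (fun z => nat_rec (fun=> nat) (f z) (g z) (b z)).
Proof.
move=> [ef Hf] cb [eg Hg].
suff cr : computable2 (fun z n => nat_rec (fun=> nat) (f z) (g z) n).
  exact: computable2_app cr computable_id cb.
exists (pr_rec ef eg) => z; rewrite -{1}(npair_nfst_nsnd z).
elim: (nsnd z) => [|n IHn] /=; first exact: ev_rec0.
apply: ev_recS IHn _.
by have := Hg (npair (nfst z) (npair n
  (nat_rec (fun=> nat) (f (nfst z)) (g (nfst z)) n))); rewrite !npairE.
Qed.

(** A case distinction is a recursion whose step discards the previous value. *)
Lemma computable_case (a f : nat -> nat) (g : nat -> nat -> nat) :
  computable a -> computable f -> computable2 g ->
  computable (fun z => if a z is k.+1 then g z k else f z).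
Proof.
move=> ca cf cg; have cg' : computable (fun w => g (nfst w) (nfst (nsnd w))).
  apply: (computable2_app cg); first exact: computable_fst computable_id.
  exact: computable_fst (computable_snd computable_id).
apply: computable_ext (@computable_rec f a (fun z k _ => g z k) cf ca cg').
by move=> z; case: (a z).
Qed.

Lemma computable_pred f : computable f -> computable (fun x => (f x).-1).
Proof.
move=> cf; have cs := computable_snd computable_id.
apply: computable_ext (computable_case (g := fun _ k => k) cf (computable_const 0) cs) => z.
by case: (f z).
Qed.

Lemma computable_if (P : nat -> bool) (f g : nat -> nat) :
  decidable1 P -> computable f -> computable g ->
  computable (fun z => if P z then f z else g z).
Proof.
move=> dP cf cg.
apply: computable_ext (computable_case dP cg (computable2_l cf)).
by move=> z; case: (P z).
Qed.

Lemma decidable1_comp P f : decidable1 P -> computable f -> decidable1 (fun x => P (f x)).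
Proof. by move=> dP cf; apply: computable_comp dP cf. Qed.

Lemma decidable1_neg P : decidable1 P -> decidable1 (fun x => ~~ P x).
Proof.
move=> dP; apply: computable_ext (computable_if dP (computable_const 0) (computable_const 1)).
by move=> z; case: (P z).
Qed.

Lemma decidable1_and P Q :
  decidable1 P -> decidable1 Q -> decidable1 (fun x => P x && Q x).
Proof.
move=> dP dQ; apply: computable_ext (computable_if dP dQ (computable_const 0)).
by move=> z; case: (P z).
Qed.

Lemma decidable1_eq0 f : computable f -> decidable1 (fun x => f x == 0).
Proof.
move=> cf; apply: computable_ext
  (computable_case cf (computable_const 1) (computable2_l (computable_const 0))).
by move=> z; case: (f z).
Qed.

Lemma decidable1_bexists (P : nat -> nat -> bool) (b : nat -> nat) :
  decidable1 (fun w => P (nfst w) (nsnd w)) -> computable b ->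
  decidable1 (fun z => has (P z) (iota 0 (b z))).
Proof.
move=> dP cb.
have c : computable (fun z => nat_rec (fun=> nat) 0 (fun k y => if P z k then 1 else y) (b z)).
  apply: (@computable_rec (fun=> 0) b (fun z k y => if P z k then 1 else y)) => //.
    exact: computable_const.
  apply: (@computable_if (fun w => P (nfst w) (nfst (nsnd w)))).
  - have := decidable1_comp dP (computable_pair (computable_fst computable_id)
      (computable_fst (computable_snd computable_id))).
    by apply: computable_ext => x; rewrite !npairE.
  - exact: computable_const.
  - exact: computable_snd (computable_snd computable_id).
apply: computable_ext c => z; elim: (b z) => [//|n IHn].
by rewrite -(addn1 n) iotaD has_cat addn1 /= orbF IHn; case: (P z n); rewrite ?orbT ?orbF.
Qed.

(** * Step-bounded evaluation and the normal form of c.e. predicates *)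

(* State of the search for the least [m] with [h m = 1] after [n] steps, where [h] returns
   [0] for "no value" and [y.+1] for the value [y]: [0] if the search is blocked, [1] if it
   is still running, and [m.+2] if it has found [m]. *)
Definition mu_search (h : nat -> nat) : nat -> nat :=
  nat_rec (fun=> nat) 1 (fun m s =>
    if s == 1 then (if h m is k.+1 then if k is _.+1 then 1 else m.+2 else 0) else s).

(* Evaluation in which every unbounded search is cut off after [n] steps; [0] means "no
   value yet" and [y.+1] means the value [y]. *)
Fixpoint bev (e : prf) (n x : nat) : nat :=
  match e with
  | pr_zero => 1
  | pr_succ => x.+2
  | pr_fst => (nfst x).+1
  | pr_snd => (nsnd x).+1
  | pr_pair f g =>
      if bev f n x is a.+1 then if bev g n x is b.+1 then (npair a b).+1 else 0 else 0
  | pr_comp f g => if bev g n x is y.+1 then bev f n y else 0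
  | pr_rec f g =>
      nat_rec (fun=> nat) (bev f n (nfst x))
        (fun k r => if r is y.+1 then bev g n (npair (nfst x) (npair k y)) else 0)
        (nsnd x)
  | pr_mu f => (mu_search (fun m => bev f n (npair x m)) n).-1
  end.

Lemma bev_sound e n x y : bev e n x = y.+1 -> eval e x y.
Proof.
elim: e x y => [||||f IHf g IHg|f IHf g IHg|f IHf g IHg|f IHf] x y /=.
- by case=> <-; apply: ev_zero.
- by case=> <-; apply: ev_succ.
- by case=> <-; apply: ev_fst.
- by case=> <-; apply: ev_snd.
- case Ef: bev => [//|a]; case Eg: bev => [//|b] [<-].
  by apply: ev_pair; [apply: IHf|apply: IHg].
- by case Eg: bev => [//|a] Ef; apply: ev_comp (IHg _ _ Eg) (IHf _ _ Ef).
- rewrite -{4}(npair_nfst_nsnd x); elim: (nsnd x) y => [|k IHk] y /=.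
    by move=> E; apply: ev_rec0; apply: IHf.
  case Er: (nat_rec _ _ _ k) => [//|r] E.
  exact: ev_recS (IHk _ Er) (IHg _ _ E).
- set S := mu_search _.
  (* State 1 has to record that every earlier [m] gave a successor value, as [ev_mu] demands. *)
  have inv k : (S k = 1 -> forall m, m < k -> exists j, eval f (npair x m) j.+1) /\
      (forall m, S k = m.+2 -> eval (pr_mu f) x m).
    elim: k => [|k [IH1 IH2]]; first by split.
    rewrite {1 2}/S /= -/(S k); case: eqP => [S1|Sn1]; last first.
      by split=> // m; apply: IH2.
    case E: bev => [|[|j]]; split=> //.
      by move=> m [<-]; apply: ev_mu; [apply: IHf|apply: IH1].
    move=> _ m; rewrite ltnS leq_eqVlt => /orP[/eqP->|]; last exact: IH1.
    by exists j; apply: IHf.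
  case E: (S n) => [//|[//|m]] /= [<-].
  exact: (inv n).2.
Qed.

Lemma uniform_threshold (P : nat -> nat -> Prop) n :
  (forall m, m < n -> exists N, forall k, N <= k -> P m k) ->
  exists N, forall m k, m < n -> N <= k -> P m k.
Proof.
elim: n => [|n IHn] H; first by exists 0.
have [m mn|N HN] := IHn; first exact/H/ltnW.
have [N' HN'] := H n (ltnSn n).
exists (maxn N N') => m k; rewrite ltnS leq_eqVlt geq_max => /orP[/eqP->|mn] /andP[? ?].
  exact: HN'.
exact: HN.
Qed.

(** The claim is made for all large bounds, so that the thresholds of several subevaluations combine
    by taking a maximum. *)
Lemma bev_complete e x y : eval e x y -> exists N, forall n, N <= n -> bev e n x = y.+1.
Proof.
elim: e x y => [||||f IHf g IHg|f IHf g IHg|f IHf g IHg|f IHf] x y.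
1-4: by move=> /eval_inv->; exists 0.
- move=> /eval_inv[a [b [-> Ha Hb]]].
  have [N HN] := IHf _ _ Ha; have [N' HN'] := IHg _ _ Hb.
  by exists (maxn N N') => n; rewrite geq_max /= => /andP[/HN-> /HN'->].
- move=> /eval_inv[u Hg Hf].
  have [N HN] := IHg _ _ Hg; have [N' HN'] := IHf _ _ Hf.
  by exists (maxn N N') => n; rewrite geq_max /= => /andP[/HN-> /HN'->].
- rewrite -{1}(npair_nfst_nsnd x) /=; elim: (nsnd x) y => [|k IHk] y /= /eval_inv.
    by rewrite !npairE => /IHf.
  rewrite !npairE => -[u /IHk[N HN] /IHg[N' HN']].
  by exists (maxn N N') => n; rewrite geq_max /= => /andP[/HN-> /HN'->].
- move=> /eval_inv[H0 Hlt].
  have [N0 HN0] := IHf _ _ H0.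
  have [m /Hlt[j /IHf[N HN]]|N1 HN1] :=
      @uniform_threshold (fun m k => exists j, bev f k (npair x m) = j.+2) y.
    by exists N => k /HN; exists j.
  (* The search takes [y.+1] steps to test [y] itself; [N0] covers the value at [y] and [N1] those
     below it. *)
  exists (maxn y.+1 (maxn N0 N1)) => n; rewrite !geq_max /= => /and3P[yn /HN0 E0 N1n].
  set S := mu_search _.
  have S1 k : k <= y -> S k = 1.
    elim: k => [//|k IHk] ky; rewrite /S /= -/(S k) IHk ?(ltnW ky)//=.
    by have [j ->] := HN1 k n ky N1n.
  have Sy k : y < k -> S k = y.+2.
    elim: k => [//|k IHk]; rewrite ltnS leq_eqVlt => /orP[/eqP<-|/IHk E].
      by rewrite /S /= -/(S y) S1 //= E0.
    by rewrite /S /= -/(S k) E.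
  by rewrite Sy.
Qed.

Lemma computable_bev e : computable2 (fun n x => bev e n x).
Proof.
have ci := computable_id.
have c1 := computable_fst ci; have c2 := computable_snd ci.
have c12 := computable_fst c2; have c22 := computable_snd c2.
have c11 := computable_fst c1; have c21 := computable_snd c1.
elim: e => [||||f IHf g IHg|f IHf g IHg|f IHf g IHg|f IHf]; rewrite /computable2 /=.
- exact: computable_const.
- exact/computable_succ/computable_succ.
- exact: computable_succ.
- exact: computable_succ.
- apply: (@computable_case _ (fun=> 0) (fun z a =>
    if bev g (nfst z) (nsnd z) is b.+1 then (npair a b).+1 else 0)) => //.
    exact: computable_const.
  apply: (@computable_case (fun w => bev g (nfst (nfst w)) (nsnd (nfst w))) (fun=> 0)
    (fun w b => (npair (nsnd w) b).+1)).
  - exact: computable2_app IHg c11 c21.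
  - exact: computable_const.
  - by apply/computable_succ/computable_pair.
- apply: (@computable_case _ (fun=> 0) (fun z y => bev f (nfst z) y)) => //.
    exact: computable_const.
  exact: computable2_app IHf c11 c2.
- apply: (@computable_rec (fun z => bev f (nfst z) (nfst (nsnd z))) _
    (fun z k r => if r is y.+1 then
       bev g (nfst z) (npair (nfst (nsnd z)) (npair k y)) else 0)) => //.
    exact: computable2_app IHf c1 c12.
  apply: (@computable_case _ (fun=> 0) (fun w y => bev g (nfst (nfst w))
    (npair (nfst (nsnd (nfst w))) (npair (nfst (nsnd w)) y)))) => //.
    exact: computable_const.
  apply: (computable2_app IHg); first exact: computable_fst.
  apply: computable_pair; first exact/computable_fst/computable_snd.
  by apply: computable_pair => //; exact/computable_fst/computable_snd.
- apply: computable_pred; apply: (@computable_rec (fun=> 1) _ (fun z m s => if s == 1 then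
    (if bev f (nfst z) (npair (nsnd z) m) is k.+1 then if k is _.+1 then 1 else m.+2 else 0)
    else s)) => //.
    exact: computable_const.
  apply: (@computable_if (fun w => nsnd (nsnd w) == 1)) => //.
    have : computable (fun w => ((nsnd (nsnd w)).-1 == 0) && ~~ (nsnd (nsnd w) == 0) : nat).
      apply: decidable1_and; first exact/decidable1_eq0/computable_pred.
      exact/decidable1_neg/decidable1_eq0.
    by apply: computable_ext => w; case: (nsnd (nsnd w)) => [|[|]].
  apply: (@computable_case _ (fun=> 0)
    (fun w k => if k is _.+1 then 1 else (nfst (nsnd w)).+2)).
  - by apply: (computable2_app IHf) => //; apply: computable_pair.
  - exact: computable_const.
  - apply: (@computable_case _ _ (fun _ _ => 1)) => //.
      exact/computable_succ/computable_succ/computable_fst/computable_snd.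
    exact: computable_const.
Qed.

(** The step bound of [bev] serves as the witness of halting. *)
Lemma halts_witness e :
  exists2 P : nat -> nat -> bool, decidable1 (fun w => P (nfst w) (nsnd w)) &
    forall x, halts e x <-> exists n, P x n.
Proof.
exists (fun x n => ~~ (bev e n x == 0)).
  apply: decidable1_neg; apply: decidable1_eq0.
  exact: computable2_app (computable_bev e) (computable_snd computable_id)
    (computable_fst computable_id).
move=> x; split=> [[y /bev_complete[N /(_ N (leqnn N)) E]]|[n]].
  by exists N; rewrite E.
by case E: bev => [//|y] _; exists y; apply: bev_sound E.
Qed.

(** [pr_mu e] looks for a zero, so [e] computes the negation of [P]; being total, [e] returns 1 at
    each failed candidate and lets the search go on. *)
Lemma witness_halts (P : nat -> nat -> bool) : decidable1 (fun w => P (nfst w) (nsnd w)) ->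
  exists e, forall x, halts e x <-> exists n, P x n.
Proof.
move=> /decidable1_neg[e He].
have {}He x n : eval e (npair x n) (~~ P x n) by have := He (npair x n); rewrite !npairE.
exists (pr_mu e) => x; split=> [[n H]|exP].
  have [H0 _] := eval_inv H; exists n.
  by move: (eval_det H0 (He x n)); case: (P x n).
exists (ex_minn exP); case: ex_minnP => n Pn minn; apply: ev_mu.
  by have := He x n; rewrite Pn.
move=> m mn; exists 0; have := He x m; case Pm: (P x m) => //.
by have := minn _ Pm; rewrite leqNgt mn.
Qed.

(** * Coding of strings and decidability of the prefix relation *)

Lemma scode_surj n : exists s, scode s = n.
Proof.
have [m] := ubnP n; elim: m n => // m IHm [|n] nm; first by exists [::].
have [|s Es] := IHm n./2; first by rewrite -ltnS (leq_ltn_trans _ nm)// ltnS -divn2 leq_div.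
(* A nonzero code [n.+1] has first letter [odd n], and [n./2] codes the rest. *)
by exists (odd n :: s); rewrite /= Es mul2n addn1 addSn addnC odd_double_half.
Qed.

Lemma scode_cons b s : scode (b :: s) = (b + (scode s).*2).+1.
Proof. by rewrite /= mul2n addn1 addSn addnC. Qed.

Lemma half_scode_cons (b : bool) s : (b + (scode s).*2)./2 = scode s.
Proof. by rewrite half_bit_double. Qed.

Lemma odd_scode_cons (b : bool) s : odd (b + (scode s).*2) = b.
Proof. by rewrite oddD odd_double addbF; case: b. Qed.

Lemma size_le_scode s : size s <= scode s.
Proof.
elim: s => // b s IHs; rewrite scode_cons ltnS (leq_trans IHs)//.
by rewrite -addnn addnA leq_addl.
Qed.

(** Makes minimality decidable: the proper prefixes of a string are found by a bounded search below
    its code. *)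
Lemma prefix_scode_lt s s' : prefix s s' -> s != s' -> scode s < scode s'.
Proof.
elim: s s' => [|b s IHs] [|b' s'] //; first by rewrite scode_cons.
rewrite prefix_cons eqseq_cons => /andP[/eqP<-]; rewrite eqxx !scode_cons => /IHs + /= sNs'.
by move=> /(_ sNs'); rewrite ltnS ltn_add2l ltn_double.
Qed.

(* One comparison step on a pair of codes: strip equal first letters; on a mismatch,
   [npair 1 0] is an absorbing pair with nonzero first component. *)
Definition prefix_step (z : nat) : nat :=
  if nfst z is a.+1 then
    if nsnd z is b.+1 then
      if odd a == odd b then npair a./2 b./2 else npair 1 0
    else z
  else z.

(** Each step strips a letter and a string is no longer than its code, so [a] iterations settle the
    comparison. *)
Definition prefix_code (a b : nat) : bool := nfst (iter a prefix_step (npair a b)) == 0.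

Lemma prefix_codeE s t : prefix_code (scode s) (scode t) = prefix s t.
Proof.
suff E k : size s <= k ->
    (nfst (iter k prefix_step (npair (scode s) (scode t))) == 0) = prefix s t.
  exact/E/size_le_scode.
have fix0 b j : iter j prefix_step (npair 0 b) = npair 0 b.
  by elim: j => [//|j]; rewrite iterS => ->; rewrite /prefix_step nfst_npair.
have fixS a j : iter j prefix_step (npair a.+1 0) = npair a.+1 0.
  by elim: j => [//|j]; rewrite iterS => ->; rewrite /prefix_step !npairE.
elim: s t k => [|b s IHs] t k; first by rewrite fix0 nfst_npair prefix0s.
case: t => [|b' t] szk; first by rewrite [scode [::]]/= scode_cons fixS nfst_npair.
case: k szk => // k szk; rewrite iterSr prefix_cons !scode_cons {2}/prefix_step !npairE.
rewrite !odd_scode_cons !half_scode_cons; case: (b == b'); first exact: IHs.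
by rewrite fixS nfst_npair.
Qed.

Lemma decidable1_odd f : computable f -> decidable1 (fun x => odd (f x)).
Proof.
apply: (@decidable1_comp odd).
have c : computable (fun z => nat_rec (fun=> nat) 0 (fun _ y => y == 0) z).
  apply: (@computable_rec (fun=> 0) _ (fun _ _ y => y == 0)).
  - exact: computable_const.
  - exact: computable_id.
  - exact/decidable1_eq0/computable_snd/computable_snd/computable_id.
by apply: computable_ext c; elim=> //= n ->; case: odd.
Qed.

Lemma computable_half f : computable f -> computable (fun x => (f x)./2).
Proof.
apply: (@computable_comp half).
have c : computable (nat_rec (fun=> nat) 0 (fun n y => if odd n then y.+1 else y)).
  apply: (@computable_rec (fun=> 0) _ (fun _ n y => if odd n then y.+1 else y)).
  - exact: computable_const.
  - exact: computable_id.
  - have cy := computable_snd (computable_snd computable_id).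
    apply: computable_if (computable_succ cy) cy.
    exact/decidable1_odd/computable_fst/computable_snd/computable_id.
by apply: computable_ext c; elim=> //= n ->; rewrite uphalf_half; case: odd.
Qed.

Lemma decidable1_prefix_code f g : computable f -> computable g ->
  decidable1 (fun x => prefix_code (f x) (g x)).
Proof.
have ci := computable_id; have c1 := computable_fst ci; have c2 := computable_snd ci.
have c11 := computable_fst c1; have c21 := computable_snd c1.
have cstep : computable prefix_step.
  apply: (@computable_case _ _ (fun z a => if nsnd z is b.+1 then
      if odd a == odd b then npair a./2 b./2 else npair 1 0 else z)) => //.
  apply: (@computable_case (fun w => nsnd (nfst w)) _ (fun w b =>
      if odd (nsnd w) == odd b then npair (nsnd w)./2 b./2 else npair 1 0)) => //.
  apply: (@computable_if (fun w => odd (nsnd (nfst w)) == odd (nsnd w))).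
  - apply: computable_ext (computable_if (decidable1_odd c21) (decidable1_odd c2)
      (decidable1_neg (decidable1_odd c2))).
    by move=> x; case: (odd (nsnd (nfst x))); case: odd.
  - by apply: computable_pair; apply: computable_half.
  - exact: computable_const.
suff : computable2 prefix_code by exact: computable2_app.
apply/decidable1_eq0/computable_fst.
have := computable_rec (g := fun _ _ => prefix_step) computable_id c1
  (computable_comp cstep (computable_snd c2)).
apply: computable_ext => z; rewrite npair_nfst_nsnd.
by elim: (nfst z) => //= n ->.
Qed.

(** * Uniformly c.e. sequences of sets of strings *)

Lemma unif_ceP (U : nat -> set (seq bool)) :
  unif_ce U <-> exists2 P : nat -> nat -> bool, decidable1 (fun w => P (nfst w) (nsnd w)) &
    forall i s, U i s <-> exists n, P (npair i (scode s)) n.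
Proof.
split=> [[e He]|[P /witness_halts[e He] HP]]; last by exists e => i s; rewrite HP He.
by have [P dP HP] := halts_witness e; exists P => // i s; rewrite He HP.
Qed.

Lemma unif_ce_preimage (Phi : seq bool -> seq bool -> Prop) (U : nat -> set (seq bool)) :
  (exists e, forall s t, Phi s t <-> halts e (npair (scode s) (scode t))) ->
  unif_ce U ->
  unif_ce (fun i => [set s | exists t u, [/\ Phi s t, U i u & prefix u t]]%classic).
Proof.
move=> [e He] /unif_ceP[P dP HP]; have [Q dQ HQ] := halts_witness e.
apply/unif_ceP.
have ci := computable_id; have c1 := computable_fst ci; have c2 := computable_snd ci.
(* The witness [n] codes [((t, u), (k, l))], with [k] and [l] witnesses for [Phi s t] and
   [U i u]. *)
exists (fun x n => [&& prefix_code (nsnd (nfst n)) (nfst (nfst n)),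
    Q (npair (nsnd x) (nfst (nfst n))) (nfst (nsnd n)) &
    P (npair (nfst x) (nsnd (nfst n))) (nsnd (nsnd n))]).
  have c21 := computable_fst c2; have c22 := computable_snd c2.
  apply: decidable1_and; first by apply: decidable1_prefix_code;
    [exact: computable_snd|exact: computable_fst].
  apply: decidable1_and.
    apply: (computable2_app (f := fun x n => Q x n : nat)) => //; last exact: computable_fst.
    by apply: computable_pair; [exact: computable_snd|exact: computable_fst].
  apply: (computable2_app (f := fun x n => P x n : nat)) => //; last exact: computable_snd.
  by apply: computable_pair; [exact: computable_fst|exact: computable_snd].
move=> i s; split=> [[t [u [/He/HQ[k Hk] /HP[l Hl] ut]]]|[n]].
  exists (npair (npair (scode t) (scode u)) (npair k l)).
  by rewrite !npairE prefix_codeE ut Hk Hl.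
have [t Et] := scode_surj (nfst (nfst n)); have [u Eu] := scode_surj (nsnd (nfst n)).
rewrite -Et -Eu !npairE prefix_codeE => /and3P[ut HQn HPn].
exists t, u; split=> //; first by apply/He/HQ; exists (nfst (nsnd n)).
by apply/HP; exists (nsnd (nsnd n)).
Qed.

(** * Initial segments of points and prefix-free refinement *)

Lemma prefix_mkseq (X : cantor) m n : m <= n -> prefix (mkseq X m) (mkseq X n).
Proof.
by move=> mn; rewrite prefixE size_mkseq /mkseq -map_take take_iota (minn_idPl mn).
Qed.

Lemma pre_mkseq (X : cantor) n : pre (mkseq X n) X.
Proof. by move=> i; rewrite size_mkseq => lin; rewrite nth_mkseq. Qed.

Lemma preP s X : pre s X -> s = mkseq X (size s).
Proof.
move=> sX; apply: (@eq_from_nth _ false); rewrite ?size_mkseq // => i ls.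
by rewrite nth_mkseq // sX.
Qed.

Lemma prefix_pre (s s' : seq bool) X : prefix s s' -> pre s' X -> pre s X.
Proof.
move=> /prefixP[r ->] sX i ls; rewrite sX ?nth_cat ?ls //.
by rewrite size_cat ltn_addr.
Qed.

Lemma prefix_mkseqE (s : seq bool) (X : cantor) n :
  prefix s (mkseq X n) -> s = mkseq X (size s) /\ size s <= n.
Proof.
move=> p; split; last by rewrite -(size_mkseq X n); exact: size_prefix.
exact/preP/(prefix_pre p)/pre_mkseq.
Qed.

(* [D i] is the set of strings extending an element of [V i] whose membership is witnessed
   below the code of the string: it is decidable and generates the same open set as [V i],
   hence so does the set of its minimal elements. *)
Lemma unif_ce_prefix_free (V : nat -> set (seq bool)) : unif_ce V ->
  exists W : nat -> set (seq bool), [/\ unif_ce W,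
    forall i (s s' : seq bool), W i s -> W i s' -> prefix s s' -> s = s',
    forall i s, W i s -> exists2 s', V i s' & prefix s' s &
    forall i, (cylS (V i) `<=` cylS (W i))%classic].
Proof.
move=> /unif_ceP[P dP HP].
pose D i c := has (fun n => prefix_code (nfst n) c && P (npair i (nfst n)) (nsnd n))
  (iota 0 c).
pose W i c := D i c && ~~ has (fun d => prefix_code d c && D i d) (iota 0 c).
have ci := computable_id; have c1 := computable_fst ci; have c2 := computable_snd ci.
have c11 := computable_fst c1; have c21 := computable_snd c1.
have dD : decidable1 (fun x => D (nfst x) (nsnd x)).
  apply: (@decidable1_bexists (fun x n => prefix_code (nfst n) (nsnd x) &&
    P (npair (nfst x) (nfst n)) (nsnd n))) => //.
  apply: decidable1_and; first exact: decidable1_prefix_code (computable_fst c2) c21.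
  apply: (computable2_app (f := fun x n => P x n : nat)) => //; last exact: computable_snd.
  exact: computable_pair c11 (computable_fst c2).
have dW : decidable1 (fun x => W (nfst x) (nsnd x)).
  apply: (decidable1_and dD); apply: decidable1_neg.
  apply: (@decidable1_bexists (fun x d => prefix_code d (nsnd x) && D (nfst x) d)) => //.
  apply: decidable1_and; first exact: decidable1_prefix_code.
  exact: (computable2_app (f := fun x n => D x n : nat) dD).
exists (fun i => [set s | W i (scode s)]%classic); split.
- apply/unif_ceP; exists (fun x _ => W (nfst x) (nsnd x)).
    by apply: (decidable1_comp dW).
  by move=> i s; split=> [Ws|[_]]; [exists 0|]; rewrite !npairE.
- move=> i s s' /= /andP[Ds _] /andP[_ /hasPn Hs'] ss'; apply/eqP/negPn/negP => sNs'.
  have := Hs' (scode s); rewrite mem_iota /= (prefix_scode_lt ss' sNs') => /(_ isT).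
  by rewrite prefix_codeE ss' Ds.
- move=> i s /= /andP[/hasP[n _]] + _.
  have [s' Es'] := scode_surj (nfst n); rewrite -Es' prefix_codeE => /andP[s's Pn].
  by exists s' => //; apply/HP; exists (nsnd n).
- move=> i X [s /HP[n Pn] sX].
  have exD : exists m, D i (scode (mkseq X m)).
    (* An initial segment longer than [N] has a code above [N], so the bounded search in [D] reaches
       the witness; length at least [size s] makes [s] a prefix of it. *)
    pose N := npair (scode s) n; exists (maxn (size s) N.+1); apply/hasP; exists N.
      rewrite mem_iota /= (leq_trans _ (size_le_scode _))// size_mkseq.
      exact: leq_maxr.
    by rewrite !npairE prefix_codeE Pn andbT {1}(preP sX) prefix_mkseq // leq_maxl.
  case: (ex_minnP exD) => m Dm minm; exists (mkseq X m); last exact: pre_mkseq.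
  (* A prefix of this segment that lies in [D] is itself an initial segment of [X], so minimality of
     [m] forces it to have length [m]. *)
  rewrite /= /W Dm /=; apply/hasPn => d; rewrite mem_iota /= => dlt.
  have [t Et] := scode_surj d; rewrite -Et prefix_codeE; apply/negP => /andP[].
  move=> /prefix_mkseqE[tX tm]; rewrite {1}tX => /minm mt.
  have tE : size t = m by apply/eqP; rewrite eqn_leq tm.
  by move: dlt; rewrite -Et tX tE ltnn.
Qed.

(** * Kraft's inequality, compactness and the measure [lam] *)

Local Open Scope classical_set_scope.
Local Open Scope ring_scope.

Lemma prefix_total (s s' u : seq bool) : prefix s u -> prefix s' u ->
  prefix s s' || prefix s' s.
Proof.
wlog le : s s' / (size s <= size s')%N => [th su s'u|].
  by case/orP: (leq_total (size s) (size s')) => /th; [|rewrite orbC]; apply.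
rewrite !prefixE => /eqP su /eqP s'u; apply/orP; left.
by rewrite -{1}s'u -take_min (minn_idPl le) su.
Qed.

Lemma pre_total s s' X : pre s X -> pre s' X -> prefix s s' || prefix s' s.
Proof.
move=> /preP sX /preP s'X; apply: (@prefix_total s s' (mkseq X (maxn (size s) (size s')))).
  by rewrite {1}sX prefix_mkseq ?leq_maxl.
by rewrite {1}s'X prefix_mkseq ?leq_maxr.
Qed.

Lemma prefix_size_pre s s' X : pre s X -> pre s' X -> (size s <= size s')%N -> prefix s s'.
Proof. by move=> /preP sX /preP s'X le; rewrite sX s'X prefix_mkseq. Qed.

Lemma pre_nth (s : seq bool) : pre s (nth false s).
Proof. by []. Qed.

(** The expectation of [f] over uniformly chosen strings of length [L]; it stands in for integration
    when only finitely many cylinders occur. *)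
Fixpoint average {R : realType} (L : nat) (f : seq bool -> R) : R :=
  if L is L'.+1 then
    (average L' (fun u => f (false :: u)) + average L' (fun u => f (true :: u))) / 2
  else f [::].

Lemma le_average {R : realType} L (f g : seq bool -> R) :
  (forall u, size u = L -> f u <= g u) -> average L f <= average L g.
Proof.
elim: L f g => [|L IHL] f g fg /=; first exact: fg.
rewrite ler_wpM2r ?invr_ge0// lerD// IHL// => u uL; by apply: fg; rewrite /= uL.
Qed.

Lemma average_cst {R : realType} L (a : R) : average L (fun=> a) = a.
Proof. by elim: L => [//|L /= ->]; rewrite mulrDl -splitr. Qed.

Lemma average_sum {R : realType} (I : Type) (r : seq I) L (F : I -> seq bool -> R) :
  average L (fun u => \sum_(i <- r) F i u) = \sum_(i <- r) average L (F i).
Proof.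
elim: L F => [//|L IHL] F /=.
by rewrite (IHL (fun i u => F i (false :: u))) (IHL (fun i u => F i (true :: u)))
  -big_split mulr_suml.
Qed.

(** Each letter of [s] makes one of the two halves vanish, hence a factor 1/2; once [s] is exhausted
    the indicator is constantly 1. *)
Lemma average_prefix {R : realType} s L : (size s <= L)%N ->
  average L (fun u => (prefix s u)%:R : R) = 2%:R ^- size s.
Proof.
elim: s L => [|b s IHs] L.
  move=> _; rewrite /= expr0 invr1 -[RHS](average_cst L); congr average.
  by apply/funext => u; rewrite prefix0s.
case: L => // L /= sL; rewrite exprS invfM -(IHs L sL) mulrC; congr (_ * _).
by case: b sL => _; rewrite /= average_cst ?add0r ?addr0.
Qed.

Definition prefix_free (F : set (seq bool)) : Prop :=
  forall s s', F s -> F s' -> prefix s s' -> s = s'.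

(** Written as averages over strings [u] of a common length [L], both sides count prefixes of [u]:
    at most one lies in [F], and when there is one, the covering hypothesis yields one in [C]. *)
Lemma kraft_le {R : realType} (F C : seq (seq bool)) :
  uniq F -> prefix_free [set` F] ->
  cylS [set` F] `<=` cylS [set` C] ->
  \sum_(s <- F) (2%:R ^- size s : R) <= \sum_(c <- C) 2%:R ^- size c.
Proof.
move=> uF pF FC; pose L := \max_(s <- F ++ C) size s.
have szL s : s \in F ++ C -> (size s <= L)%N by move=> sFC; exact: leq_bigmax_seq.
rewrite (eq_big_seq (fun s => average L (fun u => (prefix s u)%:R))); last first.
  by move=> s sF; rewrite average_prefix// szL// mem_cat sF.
rewrite [leRHS](eq_big_seq (fun s => average L (fun u => (prefix s u)%:R))); last first.
  by move=> s sC; rewrite average_prefix// szL// mem_cat sC orbT.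
rewrite -!average_sum; apply: le_average => u uL.
have [/hasP[s sF su]|/hasPn nF] := boolP (has (fun s => prefix s u) F); last first.
  by rewrite big_seq big1 ?sumr_ge0// => s /nF; case: prefix.
rewrite (bigD1_seq s)//= su big_seq_cond big1 ?addr0 => [|s' /andP[s'F s's]]; last first.
  case s'u : prefix => //; case/negP: s's; apply/eqP.
  by case/orP: (prefix_total su s'u) => [/pF->|/pF->].
(* [u] padded with [false] is a point of its cylinder; the [c] found there has length at most [L],
   so it is a prefix of [u] itself. *)
have [|c cC cu] := FC (nth false u).
  exists s => //; exact: prefix_pre su (pre_nth (s := u)).
rewrite (big_rem c)//= (prefix_size_pre cu (pre_nth (s := u))) ?uL ?szL//; last first.
  by rewrite mem_cat cC orbT.
by rewrite lerDl sumr_ge0.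
Qed.

(* Koenig's lemma: if no finite subfamily covers [cyl s], follow extensions of [s] with the
   same property to a point of [cyl s] that no [cyl (c n)] contains. *)
Lemma cyl_finite_subcover (c : nat -> seq bool) s :
  cyl s `<=` \bigcup_n cyl (c n) -> exists N, cyl s `<=` cylS [set` mkseq c N].
Proof.
pose good t := exists N, cyl t `<=` cylS [set` mkseq c N].
have step t : ~ good t -> exists b, ~ good (rcons t b).
  move=> nt; apply: contrapT => /forallNP H; apply: nt.
  have [N0 H0] : good (rcons t false) by apply: contrapT; exact: H.
  have [N1 H1] : good (rcons t true) by apply: contrapT; exact: H.
  exists (maxn N0 N1) => X tX.
  have tX' : pre (rcons t (X (size t))) X.
    move=> i; rewrite size_rcons nth_rcons ltnS leq_eqVlt => /orP[/eqP->|lit].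
      by rewrite ltnn eqxx.
    by rewrite lit tX.
  have [d dN dX] : cylS [set` mkseq c (if X (size t) then N1 else N0)] X.
    by move: tX'; case: (X (size t)) => [/H1|/H0].
  exists d => //=; move: dN => /= /mapP[k]; rewrite mem_iota /= add0n => kN ->.
  apply: map_f; rewrite mem_iota /= add0n (leq_trans kN)//.
  by case: ifP => _; rewrite ?leq_maxl ?leq_maxr.
move=> sc; apply: contrapT => ns.
have /choice[nxt Hnxt] : forall t, exists b, ~ good t -> ~ good (rcons t b).
  move=> t; have [gt|/step[b nb]] := pselect (good t); last by exists b.
  by exists false.
pose g k := iter k (fun t => rcons t (nxt t)) s.
have ng k : ~ good (g k) by elim: k => [//|k]; exact: Hnxt.
have szg k : size (g k) = (size s + k)%N.
  by elim: k => [|k IHk]; rewrite ?addn0// addnS -IHk /g iterS size_rcons.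
have gp k j : prefix (g k) (g (k + j)%N).
  elim: j => [|j IHj]; first by rewrite addn0 prefix_refl.
  by rewrite addnS (prefix_trans IHj)// /g iterS prefix_rcons.
(* [g i.+1] has length at least [i.+1], so bit [i] is never the default. *)
pose X i := nth false (g i.+1) i.
have gX k : pre (g k) X.
  move=> i lik; rewrite /X; have li : (i < size (g i.+1))%N by rewrite szg addnS ltnS leq_addl.
  case/orP: (leq_total k i.+1) => [/subnKC E|/subnKC E].
    by have /prefixP[r] := gp k (i.+1 - k)%N; rewrite E => ->; rewrite nth_cat lik.
  by have /prefixP[r] := gp i.+1 (k - i.+1)%N; rewrite E => ->; rewrite nth_cat li.
have [n _ cX] := sc X (gX 0%N).
(* [g (size (c n))] is at least as long as [c n] and both are prefixes of [X], so it extends [c n]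
   and the first [n.+1] cylinders cover it. *)
apply: (ng (size (c n))); exists n.+1 => Y gY; exists (c n).
  by apply: map_f; rewrite mem_iota /= add0n.
apply: prefix_pre gY; apply: prefix_size_pre cX (gX _) _.
by rewrite szg leq_addl.
Qed.

Lemma cylS_finite_subcover (c : nat -> seq bool) (F : seq (seq bool)) :
  cylS [set` F] `<=` \bigcup_n cyl (c n) ->
  exists N, cylS [set` F] `<=` cylS [set` mkseq c N].
Proof.
move=> Fc; have /choice[N HN] : forall s, exists N, s \in F -> cyl s `<=` cylS [set` mkseq c N].
  move=> s; have [sF|] := boolP (s \in F); last by exists 0%N.
  have [|N HN] := @cyl_finite_subcover c s; last by exists N.
  by move=> X sX; apply: Fc; exists s.
exists (\max_(s <- F) N s) => X [s sF /(HN s sF)[d /= /mapP[k]]].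
rewrite mem_iota /= add0n => kN -> dX; exists (c k) => //=.
by apply: map_f; rewrite mem_iota /= add0n (leq_trans kN)//; exact: leq_bigmax_seq.
Qed.

(** [lam A] is an infimum over countable covers; by compactness each has a finite part covering the
    open set generated by [F], to which [kraft_le] applies. *)
Lemma kraft_lam {R : realType} (F : seq (seq bool)) (A : set cantor) :
  uniq F -> prefix_free [set` F] -> cylS [set` F] `<=` A ->
  ((\sum_(s <- F) (2%:R ^- size s : R))%:E <= lam A)%E.
Proof.
move=> uF pF FA; apply: le_ereal_inf_tmp => _ [c Ac <-].
have [N HN] := @cylS_finite_subcover c F (subset_trans FA Ac).
apply: (@le_trans _ _ (\sum_(0 <= n < N) ((2%:R ^- size (c n) : R))%:E)%E).
  rewrite sumEFin lee_fin; apply: le_trans (kraft_le uF pF HN) _.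
  by rewrite /mkseq big_map /index_iota subn0.
by apply: nneseries_lim_ge => n _ _; rewrite lee_fin invr_ge0 exprn_ge0.
Qed.

(** Ensures that [fine] in [lamPhi] discards nothing. *)
Lemma lam_fin_num {R : realType} (A : set cantor) : @lam R A \is a fin_num.
Proof.
rewrite ge0_fin_numE; last first.
  apply: le_ereal_inf_tmp => _ [c _ <-]; apply: nneseries_ge0 => n _ _.
  by rewrite lee_fin invr_ge0 exprn_ge0.
have : (@lam R A <= 2%:E)%E.
  apply: le_trans (epsilon_trick0 xpredT (ler0n R 2)).
  (* The strings of ones of lengths 0, 1, 2, ... have total weight 2, and the first cylinder is the
     whole space. *)
  apply: ereal_inf_lbound; exists (fun n => nseq n true).
    by move=> X _; exists 0%N.
  apply: eq_eseriesr => n _; by rewrite size_nseq natrX exprS invfM mulrA divff// mul1r.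
by move=> /le_lt_trans; apply; exact: ltry.
Qed.

(** A sum over a set is the supremum over its finite subsets, each again prefix-free. *)
Lemma kraft_esum {R : realType} (W : set (seq bool)) (A : set cantor) :
  prefix_free W -> cylS W `<=` A ->
  (\esum_(s in W) ((2%:R ^- size s : R))%:E <= lam A)%E.
Proof.
move=> pW WA; apply: ge_ereal_sup => _ [F [finF FW] <-].
have memF s : s \in fset_set F -> W s by rewrite in_fset_set // inE => /FW.
rewrite fsbig_finite// sumEFin; apply: kraft_lam.
- exact: fset_uniq.
- by move=> s s' /memF Ws /memF Ws'; exact: pW.
- by move=> X [s /memF Ws sX]; apply: WA; exists s.
Qed.

(** Choosing one [g s] for each [s] splits [W] into fibres [J u], and [kraft_esum] applies to each
    with the single set [A u]. *)
Lemma prefix_free_esum_le {R : realType} (W U : set (seq bool)) (A : seq bool -> set cantor) :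
  prefix_free W -> (forall s, W s -> exists2 u, U u & cyl s `<=` A u) ->
  (\esum_(s in W) ((2%:R ^- size s : R))%:E <= \esum_(u in U) lam (A u))%E.
Proof.
move=> pW WU; have /choice[g Hg] : forall s, exists u, W s -> U u /\ cyl s `<=` A u.
  move=> s; have [/WU[u Uu su]|nWs] := pselect (W s); first by exists u.
  by exists [::].
pose J u := W `&` [set s | g s = u].
have -> : (\esum_(s in W) ((2%:R ^- size s : R))%:E =
    \esum_(u in U) \esum_(s in J u) ((2%:R ^- size s : R))%:E)%E.
  rewrite esum_esum => [|u s _ _]; last by rewrite lee_fin invr_ge0 exprn_ge0.
  rewrite (@reindex_esum R _ _ W (U `*`` J) (fun s => (g s, s)))//; split.
  - by move=> s Ws /=; split; [exact: (Hg s Ws).1|].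
  - by move=> s s' _ _ [].
  - by move=> [u s] [/= Uu [Ws <-]]; exists s.
apply: le_esum => u Uu; apply: kraft_esum; first by move=> s s' [Ws _] [Ws' _]; exact: pW.
by move=> X [s [Ws <-] sX]; exact: (Hg s Ws).2.
Qed.

(** * Transfer of tests along a Turing functional *)

Theorem theorem3p3 (R : realType) (Phi : seq bool -> seq bool -> Prop) :
  turing_functional Phi ->
  computable_sm (@lamPhi R Phi) ->
  forall X : cantor, @MLR R X -> dom Phi X ->
  forall Y : cantor, (forall n, out Phi X n (Y n)) ->
  MLR_ (@lamPhi R Phi) Y.
Proof.
move=> [cePhi compPhi] _ X rX _ Y XY U [ceU rhoU] YU.
have [W [ceW pW WV VW]] := unif_ce_prefix_free (unif_ce_preimage cePhi ceU).
apply: (rX W); first (split=> // i; apply: le_trans (rhoU i)).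
  rewrite [leRHS](eq_esum (b := fun u => lam [set Z | out_ext Phi Z u])); last first.
    by move=> u _; rewrite /lamPhi fineK// lam_fin_num.
  apply: prefix_free_esum_le; first exact: pW.
  (* A string of [W i] extends some [s'] with output [t] extending [u], so all bits of [u] are
     output on its whole cylinder. *)
  move=> s /WV[s' [t [u [Phit Uu /prefixP[r tE]]]] s's]; exists u => // Z sZ j ju.
  exists s', t; split=> //; first exact: prefix_pre s's sZ.
    by rewrite tE size_cat ltn_addr.
  by rewrite tE nth_cat ju.
move=> i; apply: VW; have [u Uu uY] := YU i.
(* Requesting the bit at position [size u] provides a single output [t] strictly longer than [u]. *)
have [s [t [Phit sX ut tn]]] := XY (size u).
exists s => //; exists t, u; split=> //.
rewrite prefixE; apply/eqP; apply: (@eq_from_nth _ false).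
  by rewrite size_takel// ltnW.
move=> j; rewrite size_takel ?(ltnW ut)// => ju; rewrite nth_take//.
(* Bit [j] may come from another pair; both inputs are prefixes of [X], so consistency of [Phi]
   makes [t] and [t'] comparable and they agree at [j]. *)
have [s' [t' [Phit' s'X jt' t'n]]] := XY j; rewrite -(uY j ju) -t'n.
have /orP[/prefixP[r ->]|/prefixP[r tE]] : comparable_str t t'.
- have /orP[ss'|ss'] := pre_total sX s'X; first exact: compPhi Phit Phit' ss'.
  by rewrite /comparable_str orbC; exact: compPhi Phit' Phit ss'.
- by rewrite nth_cat (ltn_trans ju ut).
- by rewrite tE nth_cat jt'.
Qed.
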